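(* Let $\beta\geq 2$ be an integer. Then there are only finitely many pairwise non-isomorphic Shilla distance-regular graphs $\Gamma$ with $b(\Gamma)=\beta$.
   Context: A connected graph $\Gamma$ of diameter $D$ is distance-regular if there are integers $b_i,c_i$ ($0\le i\le D$) such that for any two vertices $x,y$ at distance $i$, exactly $c_i$ neighbours of $y$ are at distance $i-1$ from $x$ and exactly $b_i$ neighbours of $y$ are at distance $i+1$ from $x$. Then $\Gamma$ is regular of valency $k=b_0$, and $a_i:=k-b_i-c_i$. The eigenvalues of $\Gamma$ are those of its adjacency matrix; $\Gamma$ has exactly $D+1$ distinct eigenvalues $k=\theta_0>\theta_1>\dots>\theta_D$. A Shilla distance-regular graph is a distance-regular graph of diameter $3$ whose second largest eigenvalue satisfies $\theta_1=a_3$. For such graphs $k=(a_3-a_1)a_3$, and one defines $b(\Gamma):=a_3-a_1=k/a_3$. *)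

(* Defs.v *)
From HB Require Import structures.
From mathcomp Require Import all_boot all_order all_algebra all_field.
Set Implicit Arguments. Unset Strict Implicit. Unset Printing Implicit Defensive.
Import Order.TTheory GRing.Theory Num.Theory.

Section Graphs.
Variable T : finType.
Variable e : rel T.

Definition simple_graph : Prop := symmetric e /\ irreflexive e.

Fixpoint ball (x : T) (n : nat) : {set T} :=
  match n with
  | 0 => [set x]
  | n'.+1 => ball x n' :|: [set z | [exists y in ball x n', e y z]]
  end.

Definition gconnected : Prop := forall x y : T, y \in ball x #|T|.

(* graph distance: least n with y in ball x n (equals #|T|.+1 if unreachable) *)
Definition dist (x y : T) : nat := find (fun n => y \in ball x n) (iota 0 #|T|.+1).

Definition has_diameter (D : nat) : Prop :=
  (forall x y, dist x y <= D) /\ (exists x y, dist x y = D).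

Definition distance_regular (D : nat) (b c : nat -> nat) : Prop :=
  [/\ simple_graph, gconnected, has_diameter D,
      (forall x y, 0 < dist x y ->
         #|[set z | e y z & dist x z == (dist x y).-1]| = c (dist x y)) &
      (forall x y,
         #|[set z | e y z & dist x z == (dist x y).+1]| = b (dist x y))].

Definition adjmx : 'M[algC]_#|T| :=
  \matrix_(i, j) ((e (enum_val i) (enum_val j))%:R)%R.

End Graphs.

Definition second_largest_eigenvalue (n : nat) (A : 'M[algC]_n) (theta : algC) : Prop :=
  eigenvalue A theta /\
  exists theta0 : algC,
    [/\ eigenvalue A theta0, (theta < theta0)%R,
        (forall mu, eigenvalue A mu -> (mu <= theta0)%R) &
        (forall mu, eigenvalue A mu -> mu != theta0 -> (mu <= theta)%R)].

Definition shilla_with_b (T : finType) (e : rel T) (beta : nat) : Prop :=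
  exists b c : nat -> nat,
    let k := b 0 in
    let a1 := k - b 1 - c 1 in
    let a3 := k - b 3 - c 3 in
    [/\ distance_regular e 3 b c,
        second_largest_eigenvalue (adjmx e) (a3%:R)%R &
        (a3%:Z - a1%:Z = beta%:Z)%R].

Definition isomorphic (T T' : finType) (e : rel T) (e' : rel T') : Prop :=
  exists f : T -> T', bijective f /\ forall x y, e' (f x) (f y) = e x y.

(* Main.v *)
(* Write a for a_3 and v for the number of vertices.  Summing an eigenfunction for
   a over the spheres around a vertex gives k = a * beta, so a_1 = a - beta.  Then
   beta * (a_1 + 1) < k, so a greedy choice finds beta + 1 pairwise nonadjacent
   neighbours of a vertex; two of them have at most c_2 - 1 common neighbours
   inside the local graph, and inclusion-exclusion yields
   a <= beta * (beta + 1) * c_2.  Counting spheres, v is at most linear in a.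
   On the other hand the multiplicity m of a satisfies
   m * a^2 <= tr A^2 = v * k = v * a * beta, so m is bounded in terms of beta.
   Finally the cosine matrix of a has rank at most m, diagonal 1, and
   off-diagonal entries in {0, p, q} with p, q <> 1, so an entrywise cubic
   polynomial in it is a nonzero scalar matrix, and v <= m * (m + 1)^2. *)
Require Import Defs.
From mathcomp Require Import all_boot all_order all_algebra all_field.
From mathcomp Require Import ring zify.
Set Implicit Arguments. Unset Strict Implicit. Unset Printing Implicit Defensive.
Import Order.TTheory GRing.Theory Num.Theory.

(** * Rank inequalities and the trace of a squared Hermitian matrix *)

Section LinearAlgebra.
Local Open Scope ring_scope.

Lemma mxrank_sum_leq (F : fieldType) (I : finType) m n (B : I -> 'M[F]_(m, n)) r :
  (forall i, \rank (B i) <= r)%N -> (\rank (\sum_i B i)%R <= #|I| * r)%N.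
Proof.
move=> Br; rewrite -sum_nat_const.
elim/big_rec2: _ => [|i s A _ sA]; first by rewrite mxrank0.
exact: leq_trans (mxrank_add _ _) (leq_add (Br i) sA).
Qed.

(** A rank factorization of [A] with factors [C] and [R] splits the entrywise product into [\rank A]
    summands, each of which is [B] scaled on both sides by diagonal matrices. *)
Lemma mxrank_hadamard (F : fieldType) m n (A B : 'M[F]_(m, n)) :
  (\rank (map2_mx *%R A B) <= \rank A * \rank B)%N.
Proof.
pose C := col_base A; pose R := row_base A.
have -> : map2_mx *%R A B =
    \sum_k (diag_mx (\row_i C i k) *m B *m diag_mx (row k R)).
  apply/matrixP => i j; rewrite !mxE -{1}(mulmx_base A) mxE mulr_suml summxE.
  apply: eq_bigr => k _.
  by rewrite mul_mx_diag mxE mul_diag_mx !mxE mulrAC.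
apply: leq_trans (mxrank_sum_leq (r := \rank B) _) _; last by rewrite card_ord.
move=> k; exact: leq_trans (mxrankM_maxl _ _) (mxrankM_maxr _ _).
Qed.

Lemma mxrank_nz_rows (F : fieldType) m n (A : 'M[F]_(m, n)) (P : pred 'I_m) :
  (forall i, ~~ P i -> row i A = 0) -> (\rank A <= #|P|)%N.
Proof.
move=> A0.
have -> : A = \sum_(i | P i) delta_mx i 0 *m row i A.
  apply/matrixP => i j; rewrite summxE.
  have [Pi|nPi] := boolP (P i).
    rewrite (bigD1 i) //= big1 ?addr0 => [|k /andP[_ ki]].
      by rewrite mxE big_ord1 !mxE !eqxx mul1r.
    by rewrite mxE big_ord1 !mxE eq_sym (negPf ki) mul0r.
  rewrite big1 => [|k Pk].
    by have := A0 _ nPi => /rowP/(_ j); rewrite !mxE.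
  rewrite mxE big_ord1 !mxE; case: eqP => [ik|_]; last by rewrite mul0r.
  by rewrite ik Pk in nPi.
rewrite -sum1_card; elim/big_rec2: _ => [|i s B _ sB]; first by rewrite mxrank0.
apply: leq_trans (mxrank_add _ _) (leq_add _ sB).
by apply: leq_trans (mxrankM_maxl _ _) _; apply: rank_leq_col.
Qed.

(** The columns of [M] lie in the [t]-eigenspace, so [\rank M] is at most the multiplicity of [t].
    The trace is the sum of the squared eigenvalues, which are real, so discarding those other than
    [t] only lowers it. *)
Lemma rank_eigen_trace n (A M : 'M[algC]_n) (t : algC) :
  A \is hermsymmx -> A *m M = t *: M -> t \is Num.real ->
  (\rank M)%:R * t ^+ 2 <= \tr (A *m A).
Proof.
move=> hA AM tR.
have dR := hermitian_spectral_diag_real hA.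
have /orthomx_spectralP := hermitian_normalmx hA.
set P := spectralmx A; set d := spectral_diag A => eA.
have uP : P \in unitmx by exact: spectral_unit.
have -> : \tr (A *m A) = \sum_i d 0 i ^+ 2.
  have -> : A *m A = invmx P *m (diag_mx d *m diag_mx d *m P).
    by rewrite [in LHS]eA !mulmxA mulmxK.
  rewrite mxtrace_mulC mulmxK // mul_diag_mx /mxtrace.
  by apply: eq_bigr => i _; rewrite !mxE eqxx mulr1n.
(* In spectral coordinates, row i of [P *m M] is multiplied both by [d 0 i] and by [t], hence
   vanishes unless the two agree. *)
have dPM : diag_mx d *m (P *m M) = t *: (P *m M).
  by rewrite scalemxAr -AM eA !mulmxA mulmxV // mul1mx.
pose J := [pred i | d 0 i == t].
have rk : (\rank M <= #|J|)%N.
  rewrite -(eqmxMfull M (_ : row_full P)) ?row_full_unit //.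
  apply: mxrank_nz_rows => i /= dit; apply/rowP => j; rewrite !mxE.
  move/matrixP: dPM => /(_ i j); rewrite mul_diag_mx !mxE => /eqP.
  rewrite -subr_eq0 -mulrBl mulf_eq0 subr_eq0 (negPf dit) /=.
  by move/eqP.
have sq_ge0 (i : 'I_n) : 0 <= d 0 i ^+ 2.
  by rewrite real_exprn_even_ge0 //; exact: (mxOverP dR).
apply: (@le_trans _ _ (\sum_(i | d 0 i == t) d 0 i ^+ 2)); last first.
  by rewrite [leRHS](bigID (fun i => d 0 i == t)) /= lerDl sumr_ge0.
rewrite (eq_bigr (fun=> t ^+ 2)) => [|i /eqP-> //].
rewrite sumr_const -[leRHS]mulr_natl ler_wpM2r ?ler_nat //.
by rewrite real_exprn_even_ge0.
Qed.

End LinearAlgebra.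

(** * Graph distance in a connected graph *)

Section Distance.
Variables (T : finType) (e : rel T).
Hypotheses (e_sym : symmetric e) (e_irr : irreflexive e) (e_conn : gconnected e).

Local Notation d := (dist e).

Lemma ball_mono x m n : m <= n -> ball e x m \subset ball e x n.
Proof.
move/subnK<-; elim: (n - m) => [|i IH]; first by rewrite add0n.
by rewrite addSn; apply: subset_trans IH (subsetUl _ _).
Qed.

(** Connectedness makes the search in [dist] succeed, so its out-of-range value never occurs;
    monotonicity of balls does the rest. *)
Lemma mem_ball x y n : (y \in ball e x n) = (d x y <= n).
Proof.
have hs : has (fun n => y \in ball e x n) (iota 0 #|T|.+1).
  by apply/hasP; exists #|T|; rewrite ?mem_iota ?ltnS ?leqnn //; apply: e_conn.
have yd : y \in ball e x (d x y).
  have := nth_find 0 hs; rewrite nth_iota //.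
  by move: hs; rewrite has_find size_iota.
apply/idP/idP => [yn|dn]; last exact: subsetP (ball_mono x dn) y yd.
rewrite leqNgt; apply/negP => nd.
have := before_find 0 nd; rewrite nth_iota ?add0n ?yn //.
by apply: ltn_trans nd _; move: hs; rewrite has_find size_iota.
Qed.

Lemma dist_eq0 x y : (d x y == 0) = (y == x).
Proof. by rewrite -leqn0 -mem_ball inE. Qed.

Lemma distxx x : d x x = 0.
Proof. by apply/eqP; rewrite dist_eq0. Qed.

Lemma dist_le_step x y z : e y z -> d x z <= (d x y).+1.
Proof.
move=> eyz; rewrite -mem_ball !inE; apply/orP; right.
by apply/existsP; exists y; rewrite mem_ball leqnn.
Qed.

Lemma dist_pred x y n : d x y = n.+1 -> exists2 z, e z y & d x z = n.
Proof.
move=> dn; have : y \in ball e x n.+1 by rewrite mem_ball dn.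
rewrite !inE mem_ball dn ltnn /= => /existsP[z /andP[]].
rewrite mem_ball => zn ezy; exists z => //.
by apply/eqP; rewrite eqn_leq zn -ltnS -dn dist_le_step.
Qed.

Lemma dist_eq1 x y : (d x y == 1) = e x y.
Proof.
apply/eqP/idP => [/dist_pred[z ezy /eqP]|exy].
  by rewrite dist_eq0 => /eqP<-.
have := dist_le_step x exy; rewrite distxx.
case: (d x y =P 0) => [/eqP|/eqP]; last by lia.
by rewrite dist_eq0 => /eqP yx; rewrite yx e_irr in exy.
Qed.

Lemma dist_eq2 x y z : e x z -> e y z -> y != x -> ~~ e x y -> d x y = 2.
Proof.
move=> exz eyz yx nxy.
have := dist_le_step x (_ : e z y); rewrite e_sym => /(_ eyz).
move: (exz) nxy yx; rewrite -!dist_eq1 -dist_eq0 => /eqP->; lia.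
Qed.

(** * Counting in distance-regular graphs *)

Variables (D : nat) (b c : nat -> nat).
Hypothesis dr : distance_regular e D b c.

Lemma card_nbrs x : #|[set z | e x z]| = b 0.
Proof.
case: dr => _ _ _ _ /(_ x x); rewrite distxx => <-; apply: eq_card => z.
by rewrite !inE dist_eq1 andbb.
Qed.

Lemma card_nbrs_down x y i : d x y = i.+1 ->
  #|[set z | e y z & d x z == i]| = c i.+1.
Proof. by move=> di; case: dr => _ _ _ /(_ x y) + _; rewrite di; apply. Qed.

Lemma card_nbrs_up x y i : d x y = i ->
  #|[set z | e y z & d x z == i.+1]| = b i.
Proof. by move=> di; case: dr => _ _ _ _ /(_ x y); rewrite di. Qed.

Lemma nbr_dist x y z i : d x y = i.+1 -> e y z ->
  [|| d x z == i, d x z == i.+1 | d x z == i.+2].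
Proof.
move=> di eyz; have := dist_le_step x eyz; have := @dist_le_step x z y.
by rewrite e_sym => /(_ eyz); lia.
Qed.

Lemma card_nbrs_partition x y i : d x y = i.+1 ->
  c i.+1 + #|[set z | e y z & d x z == i.+1]| + b i.+1 = b 0.
Proof.
move=> di; rewrite -(card_nbrs y) -(card_nbrs_down di) -(card_nbrs_up di).
rewrite -!sum1dep_card [in RHS](bigID (fun z => d x z == i)) /= -addnA; congr addn.
rewrite [in RHS](bigID (fun z => d x z == i.+1)) /=.
congr addn; apply: eq_bigl => z; have [eyz|] //= := boolP (e y z);
  have := nbr_dist di eyz; lia.
Qed.

Lemma card_nbrs_level x y i : d x y = i.+1 ->
  #|[set z | e y z & d x z == i.+1]| = b 0 - b i.+1 - c i.+1.
Proof. move=> di; have := card_nbrs_partition di; lia. Qed.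

(** The three-term recurrence for functions of the distance to [x]; it serves for indicators of
    spheres and for the cosine sequence. *)
Lemma sum_nbrs (V : nmodType) (f : nat -> V) x y i : d x y = i.+1 ->
  (\sum_(z | e y z) f (d x z) =
   f i *+ c i.+1 + f i.+1 *+ (b 0 - b i.+1 - c i.+1) + f i.+2 *+ b i.+1)%R.
Proof.
move=> di; rewrite -(card_nbrs_level di) -(card_nbrs_up di) -(card_nbrs_down di).
have sum_level j : (\sum_(z | e y z && (d x z == j)) f (d x z) =
    f j *+ #|[set z | e y z & d x z == j]|)%R.
  rewrite -sumr_const; apply: eq_big => [z|z /andP[_ /eqP->]] //.
  by rewrite inE.
rewrite -!sum_level (bigID (fun z => d x z == i)) /= -addrA; congr (_ + _)%R.
rewrite (bigID (fun z => d x z == i.+1)) /=.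
congr (_ + _)%R; apply: eq_bigl => z; have [eyz|] //= := boolP (e y z);
  have := nbr_dist di eyz; lia.
Qed.

Lemma sum_nbrs0 (V : nmodType) (f : nat -> V) x :
  (\sum_(z | e x z) f (d x z) = f 1 *+ b 0)%R.
Proof.
rewrite -(card_nbrs x) -sumr_const; apply: eq_big => [z|z]; first by rewrite inE.
by rewrite -dist_eq1 => /eqP->.
Qed.

(** Double counting of the edges between two consecutive spheres. *)
Lemma card_edges_between x i :
  c i.+1 * #|[set y | d x y == i.+1]| = b i * #|[set y | d x y == i]|.
Proof.
rewrite -!sum1dep_card !big_distrr /=.
transitivity (\sum_(y | d x y == i.+1) \sum_(z | d x z == i) e y z).
  apply: eq_bigr => y /eqP dy; rewrite muln1 -(card_nbrs_down dy) -sum1dep_card.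
  rewrite [RHS]big_mkcond [LHS]big_mkcond; apply: eq_bigr => z _.
  by case: e; case: eqP.
rewrite exchange_big; apply: eq_bigr => y /eqP dy.
rewrite muln1 -(card_nbrs_up dy) -sum1dep_card.
rewrite [RHS]big_mkcond [LHS]big_mkcond; apply: eq_bigr => z _.
by rewrite e_sym; case: e; case: eqP.
Qed.

Lemma dist_leD x y : d x y <= D.
Proof. by case: dr => _ _ []. Qed.

Lemma level_nonempty i : i <= D -> exists x y, d x y = i.
Proof.
case: dr => _ _ [_ [x [y dxy]]] _ _; exists x; move: y dxy.
have {H} [j ->] : exists j, D = j + i by exists (D - i); rewrite subnK.
elim: j => [|j IH] y; first by exists y.
by rewrite addSn => /dist_pred[z _ /IH].
Qed.

Lemma c_gt0 i : i < D -> 0 < c i.+1.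
Proof.
move=> /level_nonempty[x [y dxy]]; have [z ezy dz] := dist_pred dxy.
rewrite -(card_nbrs_down dxy) card_gt0; apply/set0Pn; exists z.
by rewrite !inE e_sym ezy dz eqxx.
Qed.

Lemma b_gt0 i : i < D -> 0 < b i.
Proof.
move=> /level_nonempty[x [y dxy]]; have [z ezy dz] := dist_pred dxy.
rewrite -(card_nbrs_up dz) card_gt0; apply/set0Pn; exists y.
by rewrite !inE ezy dxy eqxx.
Qed.

Lemma b_diameter : b D = 0.
Proof.
have [x [y dxy]] := level_nonempty (leqnn D).
rewrite -(card_nbrs_up dxy); apply/eqP; rewrite cards_eq0; apply/eqP/setP => z.
rewrite !inE; apply/negP => /andP[_ /eqP]; have := dist_leD x z; lia.
Qed.

Lemma c1_eq1 : 0 < D -> c 1 = 1.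
Proof.
move=> /level_nonempty[x [y dxy]]; rewrite -(card_nbrs_down dxy).
rewrite -(cards1 x); apply: eq_card => z; rewrite !inE dist_eq0.
case: eqP => [->|]; last by rewrite andbF.
by rewrite e_sym -dist_eq1 dxy.
Qed.

Lemma bc_le i : 0 < i <= D -> b i + c i <= b 0.
Proof.
case: i => // i /= /level_nonempty[x [y /card_nbrs_partition]]; lia.
Qed.

(** * Claws in the local graph *)

Let nbrs x := [set z | e x z].
Let lball x z := [set w in nbrs x | (w == z) || e z w].

Lemma card_local_ball x z : 0 < D -> e x z -> #|lball x z| = (b 0 - b 1 - c 1).+1.
Proof.
move=> D0 exz; have dz : d x z = 1 by apply/eqP; rewrite dist_eq1.
rewrite -(card_nbrs_level dz) (cardsD1 z) !inE exz eqxx add1n; congr _.+1.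
apply: eq_card => w; rewrite !inE dist_eq1.
by have [->|] := eqVneq w z; rewrite ?e_irr //= andbC.
Qed.

(** Here [z] and [w] are at distance 2, and [x] is one of their [c 2] common neighbours but lies
    outside the local graph. *)
Lemma card_local_ballI x z w : 1 < D -> e x z -> e x w -> w \notin lball x z ->
  #|lball x z :&: lball x w| <= (c 2).-1.
Proof.
move=> D1 exz exw; rewrite !inE exw /= negb_or => /andP[wz nzw].
have dzw : d z w = 2 by apply: (@dist_eq2 z w x); rewrite // e_sym.
rewrite -(card_nbrs_down dzw) [in leqRHS](cardsD1 x) !inE !dist_eq1 (e_sym w) (e_sym z).
rewrite exz exw add1n; apply: subset_leq_card; apply/subsetP => t.
rewrite !inE dist_eq1 => /andP[/andP[ext tz] /andP[_ tw]].
have [tx|_] /= := eqVneq t x; first by rewrite tx e_irr in ext.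
move: tz tw; have [->|_] := eqVneq t z => /=.
  by rewrite eq_sym (negPf wz) /= e_sym (negPf nzw).
by have [->|_] /= := eqVneq t w; rewrite ?(negPf nzw) // => -> ->.
Qed.

(* Greedily pick s pairwise nonadjacent neighbours of x; U is the union of their
   closed neighbourhoods inside the local graph at x. *)
Lemma greedy_claw x s : 1 < D -> s.-1 * (b 0 - b 1 - c 1).+1 < b 0 ->
  exists U : {set T},
    [/\ #|U| <= s * (b 0 - b 1 - c 1).+1,
        s * (b 0 - b 1 - c 1).+1 <= #|U| + 'C(s, 2) * (c 2).-1,
        U \subset nbrs x &
        forall w, e x w -> w \notin U -> #|U :&: lball x w| <= s * (c 2).-1].
Proof.
move=> D1; set a := (b 0 - b 1 - c 1).+1.
elim: s => [|s IH] sk.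
  exists set0; rewrite cards0 sub0set; split=> // w _ _.
  by rewrite set0I cards0.
have [|U [U1 U2 Ux U3]] := IH.
  by apply: leq_ltn_trans sk; rewrite leq_mul2r leq_pred orbT.
(* The s closed neighbourhoods chosen so far are too small to cover all neighbours of [x], so a
   further choice is possible. *)
have /subsetPn[z zx zU] : ~~ (nbrs x \subset U).
  apply/negP => /subset_leq_card; rewrite card_nbrs leqNgt => /negP[].
  exact: leq_ltn_trans U1 sk.
rewrite inE in zx; have Bz := card_local_ball (ltnW D1) zx.
have := cardsUI U (lball x z); rewrite Bz -/a => UI.
have UIz := U3 z zx zU.
exists (U :|: lball x z); split.
- by rewrite mulSn addnC; lia.
- by rewrite binS bin1 mulnDl mulSn; lia.
- by rewrite subUset Ux; apply/subsetP => w; rewrite inE => /andP[].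
- move=> w xw; rewrite in_setU negb_or => /andP[wU wz].
  rewrite setIUl mulSn addnC.
  apply: leq_trans (leq_card_setU _ _) (leq_add (U3 w xw wU) _).
  exact: card_local_ballI.
Qed.

(** The union [U] lies among the [b 0] neighbours of one vertex, and each of the 'C(s, 2) pairs
    overlaps in at most [(c 2).-1] vertices. *)
Lemma claw_bound s : 1 < D -> s.-1 * (b 0 - b 1 - c 1).+1 < b 0 ->
  s * (b 0 - b 1 - c 1).+1 <= b 0 + 'C(s, 2) * (c 2).-1.
Proof.
move=> D1 sk; have [x _] := level_nonempty (leq0n D).
have [U [_ + Ux _]] := greedy_claw x D1 sk => /leq_trans; apply.
by rewrite leq_add2r -(card_nbrs x) subset_leq_card.
Qed.

End Distance.

(** * Matrices with few distinct entries *)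

Section FewEntries.
Local Open Scope ring_scope.

(* The entrywise polynomial X (X - p) (X - q) turns M into a nonzero scalar matrix. *)
Lemma size_few_entries (F : fieldType) n (M : 'M[F]_n) (p q : F) r :
  p != 1 -> q != 1 -> (forall i, M i i = 1) ->
  (forall i j, i != j -> M i j \in [:: 0; p; q]) -> (\rank M <= r)%N ->
  (n <= r * r.+1 * r.+1)%N.
Proof.
move=> p1 q1 M1 Mij Mr.
have rk (s : F) : (\rank (M - const_mx s)%R <= r.+1)%N.
  have -> : - const_mx s = (const_mx (- s) : 'cV_n) *m (const_mx 1 : 'rV_n).
    by apply/matrixP => i j; rewrite !mxE big_ord1 !mxE mulr1.
  apply: leq_trans (mxrank_add _ _) _; rewrite -[leqRHS]addn1 leq_add //.
  exact: leq_trans (mxrankM_maxl _ _) (rank_leq_col _).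
pose H := map2_mx *%R (map2_mx *%R M (M - const_mx p)) (M - const_mx q).
have HE : H = ((1 - p) * (1 - q))%:M.
  apply/matrixP => i j; rewrite !mxE.
  have [->|ij] := eqVneq i j; first by rewrite M1 mul1r mulr1n.
  rewrite mulr0n; have := Mij i j ij; rewrite !inE => /or3P[] /eqP->;
    by rewrite ?subrr ?mul0r ?mulr0 ?mul0r.
have <- : \rank H = n.
  rewrite HE mxrank_unit // -scalemx1 unitmxZ ?unitmx1 //.
  by rewrite unitfE mulf_neq0 // subr_eq0 eq_sym.
apply: leq_trans (mxrank_hadamard _ _) _; rewrite leq_mul ?rk //.
apply: leq_trans (mxrank_hadamard _ _) _; by rewrite leq_mul ?rk.
Qed.

End FewEntries.

(** * The adjacency matrix as an operator on functions *)

Section Adjacency.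
Variables (T : finType) (e : rel T).
Hypothesis e_sym : symmetric e.

Lemma sum_enum_val (V : nmodType) (f : T -> V) :
  (\sum_(i < #|T|) f (enum_val i) = \sum_x f x)%R.
Proof. by rewrite [RHS](reindex (@enum_val T T)) //; apply/onW_bij/enum_val_bij. Qed.

Lemma sum_adj (f : T -> algC) x :
  (\sum_y (e x y)%:R * f y = \sum_(y | e x y) f y)%R.
Proof.
rewrite [RHS]big_mkcond; apply: eq_bigr => y _.
by case: e; rewrite ?mul1r ?mul0r.
Qed.

Lemma adjmx_hermitian : adjmx e \is hermsymmx.
Proof.
apply: realsym_hermsym.
  by apply/is_hermitianmxP; rewrite GRing.expr0 GRing.scale1r; apply/matrixP => i j; rewrite !mxE e_sym.
by apply/mxOverP => i j; rewrite mxE realn.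
Qed.

Lemma adjmx_eigenfunction (t : algC) : eigenvalue (adjmx e) t ->
  exists2 w : T -> algC, (exists x, w x != 0%R) &
    forall y, (\sum_(z | e y z) w z = t * w y)%R.
Proof.
case/eigenvalueP => v vA v0; exists (fun x => v ord0 (enum_rank x)).
  have /rV0Pn[i vi] := v0; by exists (enum_val i); rewrite enum_valK.
move=> y; have /rowP/(_ (enum_rank y)) := vA; rewrite !mxE => <-.
rewrite -sum_adj -sum_enum_val; apply: eq_bigr => i _.
by rewrite mxE enum_rankK e_sym enum_valK mulrC.
Qed.

Lemma adjmx_trace_sq k : (forall x, #|[set z | e x z]| = k) ->
  (\tr (adjmx e *m adjmx e) = (#|T| * k)%:R)%R.
Proof.
move=> ek; rewrite natrM mulr_natl -[in RHS](card_ord #|T|) -sumr_const.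
rewrite /mxtrace; apply: eq_bigr => i _.
rewrite -(ek (enum_val i)) -sum1dep_card natr_sum -sum_adj -sum_enum_val mxE.
apply: eq_bigr => j _; rewrite !mxE (e_sym (enum_val j)) mulr1.
by case: e; rewrite ?mulr1 ?mulr0.
Qed.

End Adjacency.

(** The value of v * k / a^2 when k = a * beta and v is replaced by its linear bound in a. *)
Definition multiplicity_bound beta := (1 + beta + beta ^ 3 * beta.+1 ^ 2) * beta.

(** * Sphere sums of an eigenfunction and the valency *)

Section SphereSums.
Variables (T : finType) (e : rel T) (b c : nat -> nat).
Hypothesis dr : distance_regular e 3 b c.
Local Notation d := (dist e).
Local Notation k := (b 0).
Local Notation a1 := (b 0 - b 1 - c 1).
Local Notation a3 := (b 0 - b 3 - c 3).

Let e_sym : symmetric e. Proof. by case: dr => [[]]. Qed.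
Let e_irr : irreflexive e. Proof. by case: dr => [[]]. Qed.
Let e_conn : gconnected e. Proof. by case: dr. Qed.

Section Eigenfunction.
Local Open Scope ring_scope.
Variables (t : algC) (w : T -> algC).
Hypothesis w_eigen : forall y, \sum_(z | e y z) w z = t * w y.

Let s x i := \sum_(y | d x y == i) w y.

(** Apply the eigenvalue equation at each point of the sphere and exchange the sums: [w z] is then
    counted once per neighbour of [z] on the sphere. *)
Lemma sphere_sum x i :
  t * s x i = \sum_z w z * (\sum_(y | e z y) (d x y == i)%:R).
Proof.
rewrite /s big_distrr /= [LHS]big_mkcond /=.
transitivity (\sum_y \sum_z (if e z y then w z * (d x y == i)%:R else 0)).
  apply: eq_bigr => y _; case: eqP => _.
    rewrite -w_eigen [LHS]big_mkcond; apply: eq_bigr => z _.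
    by rewrite e_sym mulr1.
  by rewrite big1 // => z _; rewrite mulr0 if_same.
rewrite exchange_big; apply: eq_bigr => z _.
by rewrite big_distrr [RHS]big_mkcond.
Qed.

Let nbr_sums x z i :
  \sum_(y | e z y) (d x y == i)%:R =
  (if d x z is j.+1 then
    (j == i)%:R *+ c j.+1 + (j.+1 == i)%:R *+ (b 0 - b j.+1 - c j.+1)
      + (j.+2 == i)%:R *+ b j.+1
   else (1 == i)%:R *+ b 0) :> algC.
Proof.
case E: (d x z) => [|j]; last first.
  exact: (sum_nbrs e_sym e_irr e_conn dr (fun j => (j == i)%:R)).
move/eqP: E; rewrite dist_eq0 // => /eqP->.
exact: (sum_nbrs0 e_irr e_conn dr (fun j => (j == i)%:R)).
Qed.

(* The equation at distance 3 kills the sum over the sphere of radius 2. *)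
Lemma eigenvalue_a3_valency :
  (exists x, w x != 0) -> t = (a3)%:R -> (a3 * a3 = k + a1 * a3)%N.
Proof.
case=> x wx ta.
have s0 : s x 0 = w x.
  rewrite /s (eq_bigl (fun y => y == x)) ?big_pred1_eq // => y.
  by rewrite dist_eq0.
have sE i : s x i = \sum_z w z * (d x z == i)%:R.
  rewrite /s big_mkcond; apply: eq_bigr => z _.
  by case: eqP; rewrite ?mulr1 ?mulr0.
have d3 z : (d x z <= 3)%N := dist_leD dr x z.
have C1 : c 1 = 1%N := c1_eq1 e_sym e_irr e_conn dr isT.
have E0 : t * s x 0 = s x 1.
  rewrite sphere_sum sE; apply: eq_bigr => z _; rewrite nbr_sums.
  case: (d x z) (d3 z) => [|[|[|[|//]]]] _ /=;
    by rewrite ?C1 ?mul0rn ?addr0 ?mulr1n.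
have E3 : t * s x 3 = s x 2 *+ b 2 + s x 3 *+ a3.
  rewrite sphere_sum !sE -!sumrMnl -big_split; apply: eq_bigr => z _.
  rewrite nbr_sums /= -!mulrnAr -mulrDr.
  case: (d x z) (d3 z) => [|[|[|[|//]]]] _ /=;
    by rewrite ?mul0rn ?addr0 ?add0r.
have E1 : t * s x 1 = s x 0 *+ k + s x 1 *+ a1 + s x 2 *+ c 2.
  rewrite sphere_sum !sE -!sumrMnl -!big_split; apply: eq_bigr => z _.
  rewrite nbr_sums /= -!mulrnAr -!mulrDr.
  case: (d x z) (d3 z) => [|[|[|[|//]]]] _ /=;
    by rewrite ?mul0rn ?addr0 ?add0r.
have s2 : s x 2 = 0.
  move: E3; rewrite ta mulr_natl => /eqP; rewrite -subr_eq subrr eq_sym.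
  have := b_gt0 e_conn dr (isT : (2 < 3)%N).
  by rewrite mulrn_eq0 lt0n => /negPf-> /= /eqP.
(* With [s x 2] zero and [s x 1] equal to [t * w x], the equation at distance 1 reads t^2 = k + a1 *
   t after cancelling [w x]. *)
apply/eqP; rewrite -(eqr_nat algC) natrM natrD natrM.
apply/eqP/(mulIf wx); rewrite -s0 -!ta.
move: E1; rewrite s2 mul0rn addr0 -E0 mulrA => ->.
by rewrite mulrDl !mulr_natl mulrnAl.
Qed.

End Eigenfunction.

Lemma sum_levels x : #|T| = \sum_(i < 4) #|[set y | d x y == i]|.
Proof.
rewrite -sum1_card (partition_big (fun y => inord (d x y) : 'I_4) predT) //=.
apply: eq_bigr => i _; rewrite -sum1dep_card; apply: eq_bigl => y.
by rewrite -(inj_eq val_inj) /= inordK // ltnS; apply: dist_leD dr x y.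
Qed.

(** * Bounding the number of vertices linearly in a3 *)

Variable beta : nat.
Hypothesis beta_gt1 : 1 < beta.
Hypothesis k_def : k = a3 * beta.
Hypothesis a1_def : a3 = a1 + beta.

Let a3_gt0 : 0 < a3.
Proof. by have := b_gt0 e_conn dr (isT : 0 < 3); rewrite {1}k_def muln_gt0 => /andP[]. Qed.

(** This is the claw bound for beta + 1 neighbours. The greedy choice is allowed because beta * (a1
    + 1) < beta * (a1 + beta) = k, and the terms a1 * beta cancel. *)
Lemma a3_le_c2 : a3 <= beta * beta.+1 * c 2.
Proof.
have c2_gt0 : 0 < c 2 := c_gt0 e_sym e_conn dr (isT : 1 < 3).
have := @claw_bound _ _ e_sym e_irr e_conn _ _ _ dr beta.+1 isT.
have : 'C(beta.+1, 2) <= beta * beta.+1.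
  by rewrite bin2 /= mulnC -divn2 leq_div.
move: a1_def k_def beta_gt1 c2_gt0.
move: (c 2) 'C(_, _) k a3 a1 => [|w] //= C x y z -> -> b1 _ CL H.
have : C * w <= beta * beta.+1 * w by rewrite leq_mul2r CL orbT.
have lt : beta * z.+1 < (z + beta) * beta.
  by rewrite mulnC ltn_pmul2r; lia.
have {H} := H lt; lia.
Qed.

Lemma card_vertices_le :
  #|T| <= (1 + beta + beta ^ 3 * beta.+1 ^ 2) * a3.
Proof.
have [x _] := level_nonempty e_conn dr (leq0n 3).
rewrite (sum_levels x) !big_ord_recl big_ord0 /=.
have n0 : #|[set y | d x y == 0]| = 1.
  by rewrite -(cards1 x); apply: eq_card => y; rewrite !inE dist_eq0.
have n1 := card_edges_between e_sym dr x 0.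
have n2 := card_edges_between e_sym dr x 1.
have n3 := card_edges_between e_sym dr x 2.
rewrite /= in n1 n2 n3.
have C1 : c 1 = 1 := c1_eq1 e_sym e_irr e_conn dr isT.
rewrite n0 C1 mul1n muln1 in n1.
have b1k : b 1 <= k by have := bc_le e_sym e_irr e_conn dr (isT : 0 < 1 <= 3); lia.
have b2k : b 2 <= k by have := bc_le e_sym e_irr e_conn dr (isT : 0 < 2 <= 3); lia.
(* As [b 3] is 0, a3 is k - c3, so c3 = k - a3. *)
have c3 : c 3 = a3 * beta.-1.
  have := bc_le e_sym e_irr e_conn dr (isT : 0 < 3 <= 3); move: k_def beta_gt1.
  rewrite (b_diameter e_conn dr) subn0 add0n; case: (beta) => //= y.
  by rewrite mulnS; lia.
(* Multiply by a3, replace it by its bound in [c 2], and use c2 * k2 = b1 * k <= k^2. *)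
have N2 : #|[set y | d x y == 2]| <= beta ^ 3 * beta.+1 * a3.
  rewrite -(leq_pmul2l a3_gt0).
  apply: leq_trans (leq_mul a3_le_c2 (leqnn _)) _.
  rewrite -mulnA n2 n1; apply: leq_trans (leq_mul (leqnn _) (leq_mul b1k (leqnn k))) _.
  have -> : k * k = a3 * beta * (a3 * beta) by rewrite -k_def.
  by set a := a3; rewrite !expnS expn0; lia.
(* From c3 * k3 = b2 * k2 with c3 >= a3 and b2 <= k = a3 * beta. *)
have N3 : #|[set y | d x y == 3]| <= beta * #|[set y | d x y == 2]|.
  rewrite -(leq_pmul2l a3_gt0) mulnA.
  apply: (@leq_trans (c 3 * #|[set y | d x y == 3]|)).
    by rewrite [X in _ <= X * _]c3 leq_mul2r leq_pmulr ?orbT //; case: (beta) beta_gt1 => [|[]].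
  by rewrite n3 leq_mul2r -k_def b2k orbT.
have N32 := leq_trans N3 (leq_mul (leqnn beta) N2).
have -> : (1 + beta + beta ^ 3 * beta.+1 ^ 2) * a3 =
    a3 + (a3 * beta + (beta ^ 3 * beta.+1 * a3 + (beta * (beta ^ 3 * beta.+1 * a3) + 0))).
  by move: (beta ^ 3) a3 => B a; rewrite !expnS expn0; lia.
by rewrite n0 n1 -k_def !leq_add.
Qed.

(** * The cosine matrix of a3 *)

Section Cosines.
Local Open Scope ring_scope.

(* 1, p, 0, q is the standard sequence of the eigenvalue a3. *)
Let p : algC := beta%:R^-1.
Let q : algC := - ((c 2)%:R / ((b 2)%:R * beta%:R)).
Let u i := nth 0 [:: 1; p; 0; q] i.

Let beta_neq0 : beta%:R != 0 :> algC.
Proof. by rewrite pnatr_eq0; case: beta beta_gt1. Qed.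

(** The recurrence is checked at each distance: k * p = a3, then 1 + a1 * p = a3 * p, then c2 * p +
    b2 * q = 0, which dictates [q], and finally a3 * q on both sides. *)
Lemma cosine_eigenfunction x y :
  \sum_(z | e y z) u (d x z) = a3%:R * u (d x y).
Proof.
have C1 : c 1 = 1%N := c1_eq1 e_sym e_irr e_conn dr isT.
have b2_neq0 : (b 2)%:R != 0 :> algC.
  by rewrite pnatr_eq0 -lt0n; exact: (b_gt0 e_conn dr).
case E: (d x y) (dist_leD dr x y) => [|j] d3.
  move/eqP: E; rewrite dist_eq0 // => /eqP->.
  rewrite (sum_nbrs0 e_irr e_conn dr) /u /= mulr1 -[LHS]mulr_natl [X in X%:R * _]k_def natrM /p.
  by rewrite mulfK.
rewrite (sum_nbrs e_sym e_irr e_conn dr _ E).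
case: j d3 {E} => [|[|[|//]]] _ /=; rewrite /u /=.
- rewrite mul0rn addr0 a1_def natrD mulrDl mulr_natl addrC [in X in _ + X]C1.
  by rewrite /p mulfV.
- rewrite mul0rn addr0 mulr0 -[p *+ _]mulr_natl -[q *+ _]mulr_natl /p /q.
  by field; rewrite b2_neq0 beta_neq0.
(* The term in [b 3] carries [u 4], which is the default value 0 of [nth]. *)
- by rewrite !mul0rn add0r addr0 mulr_natl.
Qed.

Lemma card_vertices_bounded :
  (#|T| <= multiplicity_bound beta * (multiplicity_bound beta).+1 ^ 2)%N.
Proof.
rewrite expnS expn1 mulnA; set m := multiplicity_bound beta.
pose M : 'M[algC]_#|T| := \matrix_(i, j) u (d (enum_val j) (enum_val i)).
apply: (@size_few_entries _ _ M p q).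
- apply/eqP => p1; have : (beta%:R : algC) = 1 by rewrite -[LHS]invrK -/p p1 invr1.
  by apply/eqP; rewrite pnatr_eq1; case: beta beta_gt1 => [|[]].
- apply/eqP => q1; have : q <= 0.
    by rewrite oppr_le0 divr_ge0 ?mulr_ge0 ?ler0n.
  by rewrite q1 ler10.
- by move=> i; rewrite mxE distxx.
- move=> i j ij; rewrite mxE /u.
  have : d (enum_val j) (enum_val i) != 0%N.
    by rewrite dist_eq0 // (inj_eq enum_val_inj).
  case: (d _ _) (dist_leD dr (enum_val j) (enum_val i)) => [|[|[|[|//]]]] //= _ _;
    by rewrite !inE eqxx ?orbT.
(* Each column of [M] is a cosine eigenfunction centred at one vertex, so the trace inequality
   bounds the rank of [M]. *)
have AM : adjmx e *m M = a3%:R *: M.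
  apply/matrixP => i j; rewrite !mxE -cosine_eigenfunction -sum_adj -[RHS]sum_enum_val.
  by apply: eq_bigr => l _; rewrite !mxE.
have := rank_eigen_trace (adjmx_hermitian e_sym) AM (realn _ _).
rewrite (adjmx_trace_sq e_sym (card_nbrs e_irr e_conn dr)) -natrX -natrM ler_nat.
rewrite [X in (_ <= _ * X)%N]k_def => rk.
have a2_gt0 : (0 < a3 ^ 2)%N by rewrite expn_gt0 a3_gt0.
rewrite -(leq_pmul2r a2_gt0); apply: leq_trans rk _.
apply: leq_trans (leq_mul card_vertices_le (leqnn _)) _.
by rewrite /m /multiplicity_bound; set a := a3; rewrite !expnS expn0; lia.
Qed.

End Cosines.

End SphereSums.

(** * Finiteness from a bound on the number of vertices *)

Lemma finite_graphs_up_to N :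
  exists (n : nat) (G : 'I_n -> {n : nat & rel 'I_n}),
    forall (T : finType) (e : rel T), #|T| <= N ->
      exists i, isomorphic e (projT2 (G i)).
Proof.
(* Relations are encoded as sets of pairs, so that all graphs on at most [N] vertices form a finite
   type that can be enumerated. *)
pose X := {m : 'I_N.+1 & {set 'I_m * 'I_m}}.
pose graph (g : X) : {n : nat & rel 'I_n} :=
  existT (fun n => rel 'I_n) (tag g) (fun x y => (x, y) \in tagged g).
exists #|{: X}|, (fun i => graph (enum_val i)) => T e; rewrite -ltnS => TN.
pose E := [set xy : 'I_#|T| * 'I_#|T| | e (enum_val xy.1) (enum_val xy.2)].
pose g : X := Tagged (fun m : 'I_N.+1 => {set 'I_m * 'I_m})
  (E : {set 'I_(Ordinal TN) * 'I_(Ordinal TN)}).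
exists (enum_rank g); rewrite enum_rankK /=.
exists enum_rank; split=> [|x y]; first exact: enum_rank_bij.
by rewrite inE !enum_rankK.
Qed.

Theorem theorem9 (beta : nat) (hbeta : 2 <= beta) :
  exists (N : nat) (G : 'I_N -> {n : nat & rel 'I_n}),
    forall (T : finType) (e : rel T),
      shilla_with_b e beta ->
      exists i : 'I_N, isomorphic e (projT2 (G i)).
Proof.
have [N [G HG]] := finite_graphs_up_to
  (multiplicity_bound beta * (multiplicity_bound beta).+1 ^ 2).
exists N, G => T e [b [c /= [dr [eig _] a1_def]]]; apply: HG.
have e_sym : symmetric e by case: dr => [[]].
have [w w0 we] := adjmx_eigenfunction e_sym eig.
have := eigenvalue_a3_valency dr we w0 erefl.
have a13 : b 0 - b 3 - c 3 = b 0 - b 1 - c 1 + beta by lia.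
(* Replacing one factor a3 by a1 + beta in a3 * a3 = k + a1 * a3 leaves k = a3 * beta. *)
move=> kE; apply: (card_vertices_bounded dr hbeta _ a13).
move: kE; rewrite {1}a13 mulnDl; lia.
Qed.
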